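(* Unweighted sorted-APSD enumeration can be solved (without preprocessing) with delay in $O(\Delta)$, using $\Theta(n^2)$ lazy-initialized memory and with space complexity in $\Theta(n^2)$.
   Context: Input: a directed or undirected unweighted graph $G=(V,E)$, $V=\{1,\dots,n\}$. $\Delta$ is the maximum (out-)degree. $d(u,v)$ is the hop distance, $\infty$ if unreachable, $d(u,u)=0$. Sorted-APSD enumeration: output each triple $(u,v,d(u,v))$, $u,v\in V$, exactly once, in nondecreasing order of $d(u,v)$. Delay in $O(f)$: time to first output, between consecutive outputs, and to signal termination are each $O(f)$. Model: word RAM with word size $\Omega(\log n)$, read-only adjacency lists with constant-time access to $n$ and vertex degrees. Lazy-initialized memory: allocatable in constant time without initialization, with constant-time detection of unwritten cells. *)

(* Defs.v *)
From mathcomp Require Import all_boot.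

Set Implicit Arguments.
Unset Strict Implicit.
Unset Printing Implicit Defensive.

(** * Graphs and sorted-APSD

    A graph on n vertices is an arbitrary arc relation [e : rel 'I_n]; an
    undirected graph is given by its (symmetric) adjacency relation.  The
    ordinal [v] stands for the vertex v + 1 of V = {1, ..., n}. *)

Definition adjacency_lists (n : nat) (e : rel 'I_n) (adj : 'I_n -> seq 'I_n) :=
  forall v : 'I_n, uniq (adj v) /\ adj v =i e v.

Definition max_outdeg (n : nat) (e : rel 'I_n) : nat :=
  \max_(v < n) #|[pred w | e v w]|.

Definition walk (n : nat) (e : rel 'I_n) (u v : 'I_n) (k : nat) : bool :=
  [exists p : k.-tuple 'I_n, path e u p && (last u p == v)].

Lemma connect_walk (n : nat) (e : rel 'I_n) (u v : 'I_n) :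
  connect e u v -> exists k, walk e u v k.
Proof.
case/connectP=> p pP ->; exists (size p); apply/existsP.
by exists (in_tuple p); rewrite pP eqxx.
Qed.

(** [None] is the distance infinity. *)
Definition dist (n : nat) (e : rel 'I_n) (u v : 'I_n) : option nat :=
  match @idP (connect e u v) with
  | ReflectT uv => Some (ex_minn (connect_walk uv))
  | ReflectF _ => None
  end.

Definition dist_le (d1 d2 : option nat) : bool :=
  match d1, d2 with
  | _, None => true
  | None, Some _ => false
  | Some a, Some b => a <= b
  end.

Definition triple : Type := (nat * nat * option nat)%type.

Definition apsd_triples (n : nat) (e : rel 'I_n) : seq triple :=
  [seq ((nat_of_ord u).+1, (nat_of_ord v).+1, dist e u v)
     | u <- enum 'I_n, v <- enum 'I_n].

Definition sorted_apsd (n : nat) (e : rel 'I_n) (s : seq triple) : Prop :=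
  perm_eq s (apsd_triples e) /\ sorted dist_le [seq t.2 | t <- s].

(** * The word RAM

    Words are the naturals below 2 ^ w.  A program fixes a constant number of
    registers and a finite instruction list; every instruction takes one unit
    of time.  There are two memories: plain memory, whose initial contents are
    arbitrary, and lazy-initialized memory, which has to be allocated. *)

Variant binop : Type :=
  | OpAdd | OpSub | OpMul | OpDiv | OpMod | OpAnd | OpOr | OpXor
  | OpShl | OpShr | OpLt | OpEq.

(** [d] is the destination register; [x], [y], [a], [s], [u], [v], [i] are
    registers read; [l] is a code position. *)
Variant instr : Type :=
  | IConst (d c : nat)
  | IOp (b : binop) (d x y : nat)
  | IJump (l : nat)
  | IJumpZ (x l : nat)
  | ILoad (d a : nat)
  | IStore (a x : nat)
  | ILazyAlloc (d s : nat)
  | ILazyWritten (d a : nat)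
  | ILazyLoad (d a : nat)
  | ILazyStore (a x : nat)
  | IGetN (d : nat)
  | IGetDeg (d v : nat)
  | IGetNbr (d v i : nat)
  | IOut (u v x : nat)
  | IOutInf (u v : nat)
  | IHalt.

Record program : Type := Program { nregs : nat; code : seq instr }.

(** Subtraction wraps around modulo 2 ^ w (its first operand is at most
    2 ^ w); division by zero yields 0. *)
Definition eval_binop (w : nat) (b : binop) (x y : nat) : nat :=
  match b with
  | OpAdd => x + y
  | OpSub => 2 ^ w + x - y
  | OpMul => x * y
  | OpDiv => x %/ y
  | OpMod => x %% y
  | OpAnd => Nat.land x y
  | OpOr => Nat.lor x y
  | OpXor => Nat.lxor x y
  | OpShl => x * 2 ^ y
  | OpShr => x %/ 2 ^ y
  | OpLt => x < y
  | OpEq => x == y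
  end.

(** [plain_hw] is one more than the highest plain address accessed so far;
    [lazy_size] is the number of lazy cells allocated so far, and a lazy cell
    is unwritten when its content is [None]. *)
Record config : Type := Config {
  pc : nat;
  reg : nat -> nat;
  plain_mem : nat -> nat;
  plain_hw : nat;
  lazy_mem : nat -> option nat;
  lazy_size : nat
}.

Definition upd (T : Type) (f : nat -> T) (a : nat) (x : T) : nat -> T :=
  fun b => if b == a then x else f b.

Variant outcome : Type :=
  | Next (c : config)
  | Emit (t : triple) (c : config)
  | Stop
  | Fault.

(** Writes to a register that the program does not own are ignored, so such a
    register is constantly 0. *)
Definition set_reg (w : nat) (P : program) (c : config) (d x : nat) : config :=
  Config (pc c).+1
    (if d < nregs P then upd (reg c) d (x %% 2 ^ w) else reg c)
    (plain_mem c) (plain_hw c) (lazy_mem c) (lazy_size c).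

Definition goto (c : config) (l : nat) : config :=
  Config l (reg c) (plain_mem c) (plain_hw c) (lazy_mem c) (lazy_size c).

Definition touch_plain (c : config) (a : nat) : config :=
  Config (pc c) (reg c) (plain_mem c) (maxn (plain_hw c) a.+1)
    (lazy_mem c) (lazy_size c).

Definition store_plain (c : config) (a x : nat) : config :=
  Config (pc c).+1 (reg c) (upd (plain_mem c) a x) (plain_hw c)
    (lazy_mem c) (lazy_size c).

Definition store_lazy (c : config) (a x : nat) : config :=
  Config (pc c).+1 (reg c) (plain_mem c) (plain_hw c)
    (upd (lazy_mem c) a (Some x)) (lazy_size c).

Definition grow_lazy (c : config) (s : nat) : config :=
  Config (pc c) (reg c) (plain_mem c) (plain_hw c) (lazy_mem c) (lazy_size c + s).

(** The vertex named by a word, if any. *)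
Definition vertex_of (n x : nat) : option 'I_n :=
  if x is x'.+1 then insub x' else None.

(** The program faults when it runs off its code, names a vertex or a list
    position that does not exist, accesses a lazy cell that is not allocated,
    reads an unwritten lazy cell, or allocates past the address space. *)
Definition step (w : nat) (P : program) (n : nat) (adj : 'I_n -> seq 'I_n)
    (c : config) : outcome :=
  let r := reg c in
  let set := set_reg w P in
  match onth (code P) (pc c) with
  | None => Fault
  | Some (IConst d k) => Next (set c d k)
  | Some (IOp b d x y) => Next (set c d (eval_binop w b (r x) (r y)))
  | Some (IJump l) => Next (goto c l)
  | Some (IJumpZ x l) => Next (goto c (if r x == 0 then l else (pc c).+1))
  | Some (ILoad d a) => Next (set (touch_plain c (r a)) d (plain_mem c (r a)))
  | Some (IStore a x) => Next (store_plain (touch_plain c (r a)) (r a) (r x))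
  | Some (ILazyAlloc d s) =>
      if lazy_size c + r s <= 2 ^ w
      then Next (set (grow_lazy c (r s)) d (lazy_size c)) else Fault
  | Some (ILazyWritten d a) =>
      if r a < lazy_size c then Next (set c d (isSome (lazy_mem c (r a))))
      else Fault
  | Some (ILazyLoad d a) =>
      if r a < lazy_size c then
        if lazy_mem c (r a) is Some x then Next (set c d x) else Fault
      else Fault
  | Some (ILazyStore a x) =>
      if r a < lazy_size c then Next (store_lazy c (r a) (r x)) else Fault
  | Some (IGetN d) => Next (set c d n)
  | Some (IGetDeg d v) =>
      if vertex_of n (r v) is Some v' then Next (set c d (size (adj v')))
      else Fault
  | Some (IGetNbr d v i) =>
      if vertex_of n (r v) is Some v' then
        if onth (adj v') (r i) is Some x then Next (set c d (nat_of_ord x).+1)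
        else Fault
      else Fault
  | Some (IOut u v x) => Emit (r u, r v, Some (r x)) (goto c (pc c).+1)
  | Some (IOutInf u v) => Emit (r u, r v, None) (goto c (pc c).+1)
  | Some IHalt => Stop
  end.

(** No register, memory cell or allocation is prepared in advance; [g] is the
    arbitrary initial content of the plain memory. *)
Definition init (w : nat) (g : nat -> nat) : config :=
  Config 0 (fun _ => 0) (fun a => g a %% 2 ^ w) 0 (fun _ => None) 0.

(** [enumerates w P adj D t c s c']: started in [c], when [t] steps have been
    made since the last output (or since the start), the program outputs
    exactly the sequence [s] and then halts in [c'], and the time up to the
    next output, between any two consecutive outputs, and from the last output
    to halting is at most [D]. *)
Inductive enumerates (w : nat) (P : program) (n : nat)
    (adj : 'I_n -> seq 'I_n) (D : nat) :
    nat -> config -> seq triple -> config -> Prop :=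
  | enum_next (t : nat) (c c1 : config) (s : seq triple) (c' : config) :
      step w P adj c = Next c1 ->
      enumerates w P adj D t.+1 c1 s c' -> enumerates w P adj D t c s c'
  | enum_emit (t : nat) (c c1 : config) (o : triple) (s : seq triple)
      (c' : config) :
      step w P adj c = Emit o c1 -> t.+1 <= D ->
      enumerates w P adj D 0 c1 s c' -> enumerates w P adj D t c (o :: s) c'
  | enum_stop (t : nat) (c : config) :
      step w P adj c = Stop -> t.+1 <= D -> enumerates w P adj D t c [::] c.

(** Memory is never released, so the final configuration determines the
    space used by a run, counted in words. *)
Definition space_used (P : program) (c : config) : nat :=
  nregs P + plain_hw c + lazy_size c.

(* Main.v *)
Require Import Defs.
From mathcomp Require Import all_boot zify.

(** Run one breadth-first search from all the pairs (u, u) at once, in the graph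
    on pairs with arcs (u, v) -> (u, z) for v -> z: the distance of (u, v) from
    its start is d(u, v).  The queue is the prefix of a permutation of all pairs,
    stored with its inverse in lazily initialized memory where an unwritten cell
    means the identity.  Discovering a pair swaps it with the first one after
    the prefix, so the prefix also serves as the set of visited pairs and, when
    the queue is exhausted, the rest of the permutation lists the unreachable
    pairs without any search.  Coding the pairs so that the diagonal comes first
    makes the identity permutation a correct initial state, available in constant
    time.  Between two outputs only one adjacency list is scanned. *)

Set Implicit Arguments.
Unset Strict Implicit.
Unset Printing Implicit Defensive.

(** * Hop distance through shortest walks *)

Section Distance.

Variables (n : nat) (e : rel 'I_n).
Implicit Types u v z : 'I_n.

Lemma walkP u v k :
  reflect (exists p, [/\ size p = k, path e u p & last u p = v]) (walk e u v k).
Proof.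
apply: (iffP existsP) => [[p /andP[pP /eqP lp]]|[p [sp pP lp]]].
  by exists p; rewrite size_tuple.
have spb : size p == k by apply/eqP.
by exists (Tuple spb); rewrite /= pP lp eqxx.
Qed.

Lemma walk0 u v : walk e u v 0 = (u == v).
Proof.
apply/walkP/eqP => [[p [/size0nil -> _]] //|->].
by exists [::].
Qed.

Lemma walkS u z k : walk e u z k.+1 <-> exists2 v, walk e u v k & e v z.
Proof.
split=> [/walkP[p []]|[v /walkP[p [sp pP lp]] vz]].
  case/lastP: p => [//|p y]; rewrite size_rcons rcons_path last_rcons.
  move=> [sp] /andP[pP ey] <-; exists (last u p) => //.
  by apply/walkP; exists p.
apply/walkP; exists (rcons p z).
by rewrite size_rcons sp rcons_path pP lp vz last_rcons.
Qed.

(** Replaces the dependent match in [dist] by minimality among walk lengths, on which the later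
    facts on [dist] rest. *)
Lemma distP u v k :
  dist e u v = Some k <-> walk e u v k /\ forall j, walk e u v j -> k <= j.
Proof.
rewrite /dist; case: {-}_ / idP => [uv|nuv].
  case: ex_minnP => j wj minj; split=> [[<-] //|[wk mink]].
  by congr Some; apply/eqP; rewrite eqn_leq minj ?mink.
split=> // -[/walkP[p [_ pP lp]] _]; case: nuv.
by apply/connectP; exists p.
Qed.

Lemma walk_dist u v j :
  walk e u v j -> exists2 k, dist e u v = Some k & k <= j.
Proof.
move=> wj; have ex : exists k, walk e u v k by exists j.
case: (ex_minnP ex) => k wk mink; exists k; last exact: mink.
exact/distP.
Qed.

Lemma dist0 u v : dist e u v = Some 0 <-> u = v.
Proof.
split=> [/distP[]|->]; first by rewrite walk0 => /eqP.
by apply/distP; rewrite walk0 eqxx.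
Qed.

Lemma dist_succ u v z k : dist e u v = Some k -> e v z ->
  exists2 j, dist e u z = Some j & j <= k.+1.
Proof.
by case/distP=> wk _ vz; apply: walk_dist; apply/walkS; exists v.
Qed.

(** Take the last but one vertex of a shortest walk: a shorter walk to it would extend to a shorter
    one to [z]. *)
Lemma dist_pred u z k : dist e u z = Some k.+1 ->
  exists2 v, dist e u v = Some k & e v z.
Proof.
case/distP=> /walkS[v wk vz] mink; exists v => //.
apply/distP; split=> // j wj; rewrite -ltnS.
by apply: mink; apply/walkS; exists v.
Qed.

End Distance.

(** * Arithmetic coding of vertex pairs *)

(** The pair of a source [u] and a target [v] is encoded with the difference
    [v - u] modulo [n] as leading digit, so that the [n] pairs at distance 0
    are exactly the codes below [n]. *)
Section PairCode.

Variables (n : nat) (e : rel 'I_n).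
Implicit Types u v z : 'I_n.

Definition pair_code (u v : nat) : nat := ((v + n - u) %% n) * n + u.
Definition code_target (x : nat) : nat := (x %% n + x %/ n) %% n.

Lemma pair_code_src u v : pair_code u v %% n = u.
Proof. by rewrite /pair_code modnMDl modn_small. Qed.

Lemma pair_code_target u v : code_target (pair_code u v) = v.
Proof.
have n0 : 0 < n by apply: leq_ltn_trans (ltn_ord u).
rewrite /code_target pair_code_src /pair_code divnMDl // (divn_small (ltn_ord u)).
(* [u <= v + n], so the truncated subtraction is exact. *)
rewrite addn0 modnDmr subnKC; last by apply: leq_trans (leq_addl _ _); apply: ltnW.
by rewrite modnDr modn_small.
Qed.

Lemma ltn_pair_code u v : pair_code u v < n * n.
Proof.
have n0 : 0 < n by apply: leq_ltn_trans (ltn_ord u).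
rewrite /pair_code; have := ltn_pmod (v + n - u) n0; have := ltn_ord u; nia.
Qed.

Lemma pair_codeP x : x < n * n -> exists u v, x = pair_code u v.
Proof.
move=> ltx; have n0 : 0 < n by case: n ltx.
have ltu := ltn_pmod x n0; have ltv := ltn_pmod (x %% n + x %/ n) n0.
exists (Ordinal ltu), (Ordinal ltv); rewrite /pair_code /=.
have ltk : x %/ n < n by rewrite ltn_divLR.
suff -> : ((x %% n + x %/ n) %% n + n - x %% n) %% n = x %/ n by apply: divn_eq.
move: (x %% n) (x %/ n) ltu ltk => a k lta ltk.
(* The target is [a + k], reduced by [n] if the sum wraps around. *)
have [lt|ge] := ltnP (a + k) n.
  by rewrite (modn_small lt) -addnA addKn modnDr modn_small.
have -> : (a + k) %% n = a + k - n.
  by rewrite -{1}(subnK ge) modnDr modn_small //; lia.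
by rewrite (_ : _ - a = k) ?modn_small //; lia.
Qed.

Lemma pair_code_diag u v : (pair_code u v < n) = (u == v).
Proof.
have n0 : 0 < n by apply: leq_ltn_trans (ltn_ord u).
have ltu := ltn_ord u; have ltv := ltn_ord v.
apply/idP/eqP => [|->].
  move=> lt; rewrite -[u in LHS]/u; apply: val_inj => /=.
  have := pair_code_target u v; rewrite /code_target (divn_small lt).
  by rewrite addn0 pair_code_src modn_small.
by rewrite /pair_code addKn modnn.
Qed.

(** Total on [nat], so that the queue can be analysed on bare numbers; the two default branches are
    reached only for [n = 0]. *)
Definition code_dist (x : nat) : option nat :=
  if insub (x %% n) is Some u then
    if insub (code_target x) is Some v then dist e u v else None
  else None.

Lemma code_dist_pair u v : code_dist (pair_code u v) = dist e u v.
Proof. by rewrite /code_dist pair_code_src pair_code_target !valK. Qed.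

Definition code_triple (x : nat) : triple :=
  ((x %% n).+1, (code_target x).+1, code_dist x).

Definition code_succ (x y : nat) : Prop :=
  exists u v z, [/\ x = pair_code u v, y = pair_code u z & e v z].

Lemma pair_code_inj u v u' v' :
  pair_code u v = pair_code u' v' -> (u, v) = (u', v').
Proof.
move=> eqc; congr pair; apply: val_inj => /=.
  by rewrite -(pair_code_src u v) eqc pair_code_src.
by rewrite -(pair_code_target u v) eqc pair_code_target.
Qed.

Lemma code_dist0 x : x < n * n -> code_dist x = Some 0 <-> x < n.
Proof.
case/pair_codeP=> u [v ->]; rewrite code_dist_pair pair_code_diag.
by split=> [/dist0 ->|/eqP /dist0 //].
Qed.

Lemma code_dist_succ x y k : code_dist x = Some k -> code_succ x y ->
  exists2 j, code_dist y = Some j & j <= k.+1.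
Proof.
move=> dx [u [v [z [xE -> vz]]]]; move: dx; rewrite xE !code_dist_pair.
by move=> duv; apply: dist_succ duv vz.
Qed.

Lemma code_dist_pred y k : y < n * n -> code_dist y = Some k.+1 ->
  exists x, [/\ x < n * n, code_dist x = Some k & code_succ x y].
Proof.
case/pair_codeP=> u [z ->]; rewrite code_dist_pair => /dist_pred[v dv vz].
exists (pair_code u v); rewrite code_dist_pair ltn_pair_code.
by split=> //; exists u, v, z.
Qed.

(** Codes below [n * n] biject with pairs, so listing each code once outputs each triple once. *)
Lemma code_triples_perm xs : uniq xs -> (forall x, (x \in xs) = (x < n * n)) ->
  perm_eq (map code_triple xs) (apsd_triples e).
Proof.
move=> uxs mxs.
have -> : apsd_triples e =
    map code_triple [seq pair_code u v | u : 'I_n <- enum 'I_n, v : 'I_n <- enum 'I_n].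
  rewrite map_allpairs; apply: eq_allpairs => u v.
  by rewrite /code_triple pair_code_src pair_code_target code_dist_pair.
apply: perm_map; apply: uniq_perm => // [|x].
  apply: allpairs_uniq; rewrite ?enum_uniq // => -[u v] [u' v'] _ _ /=.
  exact: pair_code_inj.
rewrite mxs; apply/idP/allpairsP => [/pair_codeP[u [v ->]]|[[u v] [_ _ ->]]].
  by exists (u, v); rewrite !mem_enum.
exact: ltn_pair_code.
Qed.

End PairCode.

(** * Breadth-first search on a permutation and its inverse *)

Section LazyQueue.

Variables (N m : nat) (succ : nat -> nat -> Prop) (dx : nat -> option nat).

Definition inverse_on (A P : nat -> nat) : Prop :=
  forall x, x < N -> [/\ A x < N, P x < N, P (A x) = x & A (P x) = x].

(** Transposes positions [T] and [P y]. If they coincide, both updates write the same value, so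
    their order is harmless. *)
Definition enqueue_arr (A P : nat -> nat) (T y : nat) : nat -> nat :=
  upd (upd A T y) (P y) (A T).
Definition enqueue_pos (A P : nat -> nat) (T y : nat) : nat -> nat :=
  upd (upd P y T) (A T) (P y).

Section Enqueue.

Variables (A P : nat -> nat) (T y : nat).
Hypotheses (AP : inverse_on A P) (ltT : T < N) (lty : y < N).

Lemma enqueue_inverse :
  inverse_on (enqueue_arr A P T y) (enqueue_pos A P T y).
Proof.
move=> x ltx; have [Ax Px PAx APx] := AP ltx; have [Ay Py PAy APy] := AP lty.
have [AT PT PAT APT] := AP ltT; rewrite /enqueue_arr /enqueue_pos /upd.
split.
- by case: ifP => // _; case: ifP.
- by case: ifP => // _; case: ifP.
- have [->|xPy] := eqVneq x (P y); first by rewrite eqxx.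
  have [xT|xT] := eqVneq x T.
    case: (eqVneq y (A T)) => [yAT|_]; last by rewrite eqxx.
    by rewrite yAT PAT xT eqxx in xPy.
  case: (eqVneq (A x) (A T)) => [eqA|_].
    by rewrite -PAx eqA PAT eqxx in xT.
  case: (eqVneq (A x) y) => [eqA|//].
  by rewrite -eqA PAx eqxx in xPy.
- have [->|xAT] := eqVneq x (A T); first by rewrite eqxx.
  have [->|xy] := eqVneq x y.
    case: (eqVneq T (P y)) => [TPy|_]; last by rewrite eqxx.
    by rewrite TPy.
  case: (eqVneq (P x) (P y)) => [eqP|_].
    by rewrite -APx eqP APy eqxx in xy.
  case: (eqVneq (P x) T) => [eqP|//].
  by rewrite -eqP APx eqxx in xAT.
Qed.

Hypothesis geT : T <= P y.

Lemma enqueue_arr_lt i : i < T -> enqueue_arr A P T y i = A i.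
Proof. by move=> lt; rewrite /enqueue_arr /upd !ifN ?neq_ltn ?(leq_trans lt) ?lt. Qed.

Lemma enqueue_arr_tail : enqueue_arr A P T y T = y.
Proof.
by rewrite /enqueue_arr /upd eqxx; case: eqP => // ->; case: (AP lty).
Qed.

(** Only codes at positions from [T] on move, so prefixes of length at most [T] keep their sets of
    codes. *)
Lemma enqueue_pos_lt j x : j <= T -> x < N ->
  (enqueue_pos A P T y x < j) = (P x < j).
Proof.
move=> lej ltx; have [_ _ PAT _] := AP ltT; rewrite /enqueue_pos /upd.
case: eqP => [->|_]; first by rewrite PAT !ltnNge (leq_trans lej) ?lej.
by case: eqP => [->|//]; rewrite !ltnNge lej (leq_trans lej).
Qed.

(** The code displaced from [T] lands at [P y], beyond the new prefix unless it is [y] itself. *)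
Lemma enqueue_pos_ltS x : x < N ->
  (enqueue_pos A P T y x < T.+1) = (x == y) || (P x < T).
Proof.
move=> ltx; have [_ _ PAT APT] := AP ltT; have [_ _ _ APy] := AP lty.
have [_ _ _ APx] := AP ltx.
rewrite /enqueue_pos /upd; case: (eqVneq x (A T)) => [->|xAT].
  rewrite PAT ltnn orbF; case: (eqVneq (A T) y) => [<-|ne]; first by rewrite PAT ltnSn.
  apply/negbTE; rewrite -leqNgt ltn_neqAle geT andbT.
  by apply/eqP => eqT; rewrite eqT APy eqxx in ne.
case: (eqVneq x y) => [_|xy]; first by rewrite ltnSn.
rewrite ltnS leq_eqVlt; case: (eqVneq (P x) T) => [eqT|//].
by rewrite -eqT APx eqxx in xAT.
Qed.

End Enqueue.

(** [h], [T], [L]: head and tail of the queue, and end of the level [d] in it. *)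
Record bfs_inv (h T L d : nat) (A P : nat -> nat) : Prop := BfsInv {
  bfs_hL : h <= L;
  bfs_LT : L <= T;
  bfs_TN : T <= N;
  bfs_inverse : inverse_on A P;
  bfs_closed : forall i y, i < h -> y < N -> succ (A i) y -> P y < T;
  bfs_level : forall i, h <= i < L -> dx (A i) = Some d;
  bfs_next : forall i, L <= i < T -> dx (A i) = Some d.+1;
  bfs_complete : forall x k, x < N -> dx x = Some k -> k <= d -> P x < L
}.

(** The only facts on distances that the queue analysis uses. *)
Hypothesis dx0 : forall x, x < N -> dx x = Some 0 <-> x < m.
Hypothesis dx_succ : forall x y k, dx x = Some k -> succ x y ->
  exists2 j, dx y = Some j & j <= k.+1.
Hypothesis dx_pred : forall y k, y < N -> dx y = Some k.+1 ->
  exists x, [/\ x < N, dx x = Some k & succ x y].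

Lemma bfs_init : m <= N -> bfs_inv 0 m m 0 id id.
Proof.
move=> lem; split=> // [i /= lti|i|x k ltx dxk]; last first.
- by rewrite leqn0 => /eqP k0; apply/dx0; rewrite // dxk k0.
- by rewrite ltnNge andbN.
- by apply/dx0; rewrite // (leq_trans lti).
Qed.

Lemma bfs_enqueue h T L d A P y : bfs_inv h T L d A P -> h < L -> y < N ->
  succ (A h) y -> T <= P y ->
  bfs_inv h T.+1 L d (enqueue_arr A P T y) (enqueue_pos A P T y).
Proof.
case=> hL LT TN AP clo lev nxt cmp hltL lty sy geT.
have ltT : T < N by apply: leq_ltn_trans geT _; case: (AP _ lty).
have dh : dx (A h) = Some d by apply: lev; rewrite leqnn.
split=> //.
- exact: leqW.
- exact: enqueue_inverse.
- move=> i x lti ltx; rewrite enqueue_arr_lt ?enqueue_pos_ltS //; last by lia.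
  by move=> sx; rewrite (clo i x) ?orbT.
- by move=> i lti; rewrite enqueue_arr_lt ?lev //; lia.
- move=> i /andP[leL]; rewrite ltnS leq_eqVlt => /orP[/eqP ->|lti].
    rewrite enqueue_arr_tail //; have [j dj lej] := dx_succ dh sy.
    (* The arc bounds the distance of [y] by [d.+1]; a distance of at most [d] would put [y] before
       [L] by completeness, yet [T <= P y]. *)
    rewrite dj; congr Some; apply/eqP; rewrite eqn_leq lej ltnNge.
    by apply/negP => jd; have := cmp _ _ lty dj jd; lia.
  by rewrite enqueue_arr_lt ?nxt ?leL.
- by move=> x k ltx dk lek; rewrite enqueue_pos_lt // (cmp x k).
Qed.

Lemma bfs_dequeue h T L d A P : bfs_inv h T L d A P -> h < L ->
  (forall y, y < N -> succ (A h) y -> P y < T) -> bfs_inv h.+1 T L d A P.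
Proof.
case=> hL LT TN AP clo lev nxt cmp hltL sh; split=> //.
  move=> i y; rewrite ltnS leq_eqVlt => /orP[/eqP ->|lti]; first exact: sh.
  exact: clo.
by move=> i /andP[lti iL]; apply: lev; rewrite ltnW.
Qed.

(** A code at distance [d.+1] has a predecessor at distance [d], which lies before [h] and is
    already scanned, so the code is in the queue. *)
Lemma bfs_next_level h T d A P :
  bfs_inv h T h d A P -> bfs_inv h T T d.+1 A P.
Proof.
case=> hL LT TN AP clo lev nxt cmp; split=> //.
  by move=> i; rewrite ltnNge andbN.
move=> x k ltx dk; rewrite leq_eqVlt => /orP[/eqP kd|lek]; last first.
  by apply: leq_trans LT; apply: (cmp x k).
rewrite {}kd in dk; have [y [lty dy sy]] := dx_pred ltx dk.
have [_ _ _ APy] := AP y lty.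
by apply: (clo (P y)) => //; rewrite ?APy //; apply: (cmp y d).
Qed.

(** With an empty queue the visited set is closed under successors. *)
Lemma bfs_unreachable T L d A P x :
  bfs_inv T T L d A P -> x < N -> T <= P x -> dx x = None.
Proof.
case=> hL LT TN AP clo lev nxt cmp ltx geT.
case dk: (dx x) => [k|//]; suff : P x < T by rewrite ltnNge geT.
elim: k x ltx dk {geT} => [|k IHk] x ltx dk.
  by apply: leq_trans LT; apply: (cmp x 0).
have [y [lty dy sy]] := dx_pred ltx dk; have [_ _ _ APy] := AP y lty.
by apply: (clo (P y)); rewrite ?APy //; apply: IHk.
Qed.

(** Specifies the outputs still due only as a set sorted by distance, bounded below by [d]: later
    swaps may still permute the positions from the tail on. *)
Definition suffix_listing (h : nat) (d : option nat) (P : nat -> nat)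
    (xs : seq nat) : Prop :=
  [/\ uniq xs, forall x, (x \in xs) = (x < N) && (h <= P x)
    & path dist_le d (map dx xs)].

Lemma suffix_listing_nil h d A P :
  inverse_on A P -> N <= h -> suffix_listing h d P [::].
Proof.
move=> AP leh; split=> // x; rewrite in_nil; case: ltnP => //= ltx.
by have [_ Px _ _] := AP x ltx; rewrite leqNgt (leq_trans Px leh).
Qed.

Lemma suffix_listing_cons h d A P xs : inverse_on A P -> h < N ->
  dist_le d (dx (A h)) -> suffix_listing h.+1 (dx (A h)) P xs ->
  suffix_listing h d P (A h :: xs).
Proof.
move=> AP lth led [uxs mxs pxs]; have [Ah _ PAh _] := AP h lth.
split=> [|x|]; rewrite /= ?led //=.
  by rewrite mxs PAh ltnn andbF.
rewrite inE mxs; have [->|ne] := eqVneq x (A h); first by rewrite Ah PAh leqnn.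
case: ltnP => //= ltx; have [_ _ _ APx] := AP x ltx.
rewrite [RHS]leq_eqVlt; case: (eqVneq h (P x)) => [eqh|//].
by rewrite eqh APx eqxx in ne.
Qed.

Lemma suffix_listing_le h d d' P xs : dist_le d d' ->
  suffix_listing h d' P xs -> suffix_listing h d P xs.
Proof.
move=> le [uxs mxs pxs]; split=> //.
case: (map dx xs) pxs => //= a s /andP[le' ->]; rewrite andbT.
by move: d d' a le le' => [d|] [d'|] [a|] //=; apply: leq_trans.
Qed.

Lemma suffix_listing_pos h d P P' xs :
  (forall x, x < N -> (P' x < h) = (P x < h)) ->
  suffix_listing h d P' xs -> suffix_listing h d P xs.
Proof.
move=> eqP [uxs mxs pxs]; split=> // x; rewrite mxs.
by case: ltnP => //= ltx; rewrite leqNgt eqP // -leqNgt.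
Qed.

End LazyQueue.

(** Registers: 1 is the constant 1, 2 is [n], 3 is [n * n], 4 the head, 5 the
    tail, 6 the end of the current level, 7 its distance; 8 and 11 hold the
    source (from 0 and from 1), 9 the target (from 1), 10 the number of
    neighbours left to scan.  Lazy cells below [n * n] hold the array of codes,
    the next [n * n] ones the inverse array; an unwritten cell stands for the
    identity. *)
Definition apsd_code : seq instr := [::
  IConst 1 1;
  IGetN 2;
  IOp OpMul 3 2 2;
  IOp OpAdd 12 3 3;
  ILazyAlloc 13 12;
  IOp OpAdd 5 2 0;
  IOp OpAdd 6 2 0;
  (* 7: head of the main loop *)
  IOp OpLt 12 4 3;
  IJumpZ 12 58;
  IOp OpAdd 12 4 0;
  ILazyWritten 13 4;
  IJumpZ 13 13;
  ILazyLoad 12 4;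
  (* 13: decode the pair in register 12 *)
  IOp OpMod 8 12 2;
  IOp OpDiv 9 12 2;
  IOp OpAdd 9 8 9;
  IOp OpMod 9 9 2;
  IOp OpAdd 11 8 1;
  IOp OpAdd 9 9 1;
  IOp OpLt 12 4 5;
  IJumpZ 12 56;
  IOp OpEq 12 4 6;
  IJumpZ 12 25;
  IOp OpAdd 7 7 1;
  IOp OpAdd 6 5 0;
  (* 25 *)
  IOut 11 9 7;
  IGetDeg 10 9;
  (* 27: scan the neighbours *)
  IJumpZ 10 54;
  IOp OpSub 10 10 1;
  IGetNbr 12 9 10;
  IOp OpAdd 12 12 2;
  IOp OpSub 12 12 11;
  IOp OpMod 12 12 2;
  IOp OpMul 12 12 2;
  IOp OpAdd 12 12 8;
  IOp OpAdd 13 3 12;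
  IOp OpAdd 14 12 0;
  ILazyWritten 15 13;
  IJumpZ 15 40;
  ILazyLoad 14 13;
  (* 40: the position of the code in register 12 is in register 14 *)
  IOp OpLt 15 14 5;
  IJumpZ 15 43;
  IJump 27;
  (* 43: swap it with the code at the tail *)
  IOp OpAdd 16 5 0;
  ILazyWritten 15 5;
  IJumpZ 15 47;
  ILazyLoad 16 5;
  ILazyStore 5 12;
  ILazyStore 13 5;
  ILazyStore 14 16;
  IOp OpAdd 15 3 16;
  ILazyStore 15 14;
  IOp OpAdd 5 5 1;
  IJump 27;
  (* 54 *)
  IOp OpAdd 4 4 1;
  IJump 7;
  (* 56 *)
  IOutInf 11 9;
  IJump 54;
  (* 58 *)
  IHalt].

Definition apsd_program : program := Program 17 apsd_code.

(** * Weakest-precondition rules for the word RAM *)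

Section Machine.

Variables (w n : nat) (adj : 'I_n -> seq 'I_n) (D : nat).

(** Permits rounding the step counter up, which unifies branches of different lengths and gives
    loops a uniform bound. *)
Lemma enumerates_le t t' c s c' : t <= t' ->
  enumerates w apsd_program adj D t' c s c' ->
  enumerates w apsd_program adj D t c s c'.
Proof.
move=> let' en; elim: en t let' => {t' c s c'}.
- by move=> t' c c1 s c' st _ IH t let'; apply: enum_next st (IH _ _).
- by move=> t' c c1 o s c' st ltD en _ t let'; apply: enum_emit st _ en; lia.
- by move=> t' c st ltD t let'; apply: enum_stop st _; lia.
Qed.

(** A weakest precondition: from code position [k], with [t] steps made since
    the last output, registers [rs], lazy memory [l] and [sz] lazy cells, the
    program halts after outputting some sequence in [Q]. *)
Definition wp (sz t k : nat) (rs : seq nat) (l : nat -> option nat)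
    (Q : seq triple -> Prop) : Prop :=
  forall c, pc c = k -> reg c =1 nth 0 rs -> lazy_mem c = l ->
    plain_hw c = 0 -> lazy_size c = sz ->
  exists s c', [/\ enumerates w apsd_program adj D t c s c', Q s,
    plain_hw c' = 0 & lazy_size c' = n * n + n * n].

Section Instructions.

Variables (sz t k : nat) (rs : seq nat) (l : nat -> option nat).
Variable Q : seq triple -> Prop.

Local Notation instr_at ins := (onth apsd_code k = Some ins).

Lemma run_le t' : t <= t' -> wp sz t' k rs l Q -> wp sz t k rs l Q.
Proof.
move=> let' r c e1 e2 e3 e4 e5; have [s [c' [en Qs hw szc]]] := r c e1 e2 e3 e4 e5.
by exists s, c'; split=> //; apply: enumerates_le en.
Qed.

(** Common core of the register-writing rules other than allocation. Most of them then discard the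
    reduction modulo [2 ^ w] by a bound. *)
Lemma run_set d x :
  (forall c, pc c = k -> reg c =1 nth 0 rs -> lazy_mem c = l -> lazy_size c = sz ->
     step w apsd_program adj c = Next (set_reg w apsd_program c d x)) ->
  d < 17 -> wp sz t.+1 k.+1 (set_nth 0 rs d (x %% 2 ^ w)) l Q ->
  wp sz t k rs l Q.
Proof.
move=> st ltd r c pck regc lzc hwc szc.
have [|||||s [c' [en Qs hw' sz']]] := r (set_reg w apsd_program c d x) => //=.
- by rewrite pck.
- by move=> i; rewrite ltd nth_set_nth /= /upd regc.
by exists s, c'; split=> //; apply: enum_next (st c pck regc lzc szc) en.
Qed.

Lemma run_const d x : instr_at (IConst d x) -> d < 17 -> x < 2 ^ w ->
  wp sz t.+1 k.+1 (set_nth 0 rs d x) l Q -> wp sz t k rs l Q.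
Proof.
move=> ik ltd ltx; rewrite -{1}(modn_small ltx); apply: run_set => // c pck *.
by rewrite /step pck /= ik.
Qed.

Lemma run_op b d x y v : instr_at (IOp b d x y) -> d < 17 ->
  eval_binop w b (nth 0 rs x) (nth 0 rs y) %% 2 ^ w = v ->
  wp sz t.+1 k.+1 (set_nth 0 rs d v) l Q -> wp sz t k rs l Q.
Proof.
move=> ik ltd <-; apply: run_set => // c pck regc _ _.
by rewrite /step pck /= ik !regc.
Qed.

(** The program never writes register 0, so adding it copies. *)
Lemma run_move d x : instr_at (IOp OpAdd d x 0) -> d < 17 -> nth 0 rs 0 = 0 ->
  nth 0 rs x < 2 ^ w ->
  wp sz t.+1 k.+1 (set_nth 0 rs d (nth 0 rs x)) l Q -> wp sz t k rs l Q.
Proof. by move=> ik ltd r0 ltx; apply: run_op ik ltd _; rewrite /= r0 addn0 modn_small. Qed.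

Lemma run_add d x y : instr_at (IOp OpAdd d x y) -> d < 17 ->
  nth 0 rs x + nth 0 rs y < 2 ^ w ->
  wp sz t.+1 k.+1 (set_nth 0 rs d (nth 0 rs x + nth 0 rs y)) l Q ->
  wp sz t k rs l Q.
Proof. by move=> ik ltd ltx; apply: run_op ik ltd _; rewrite /= modn_small. Qed.

Lemma run_mul d x y : instr_at (IOp OpMul d x y) -> d < 17 ->
  nth 0 rs x * nth 0 rs y < 2 ^ w ->
  wp sz t.+1 k.+1 (set_nth 0 rs d (nth 0 rs x * nth 0 rs y)) l Q ->
  wp sz t k rs l Q.
Proof. by move=> ik ltd ltx; apply: run_op ik ltd _; rewrite /= modn_small. Qed.

Lemma run_sub d x y : instr_at (IOp OpSub d x y) -> d < 17 ->
  nth 0 rs y <= nth 0 rs x < 2 ^ w ->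
  wp sz t.+1 k.+1 (set_nth 0 rs d (nth 0 rs x - nth 0 rs y)) l Q ->
  wp sz t k rs l Q.
Proof.
move=> ik ltd /andP[lexy ltx]; apply: run_op ik ltd _; rewrite /= -addnBA //.
by rewrite modnDl modn_small //; lia.
Qed.

Lemma run_mod d x y : instr_at (IOp OpMod d x y) -> d < 17 ->
  nth 0 rs x < 2 ^ w ->
  wp sz t.+1 k.+1 (set_nth 0 rs d (nth 0 rs x %% nth 0 rs y)) l Q ->
  wp sz t k rs l Q.
Proof.
move=> ik ltd ltx; apply: run_op ik ltd _; rewrite /= modn_small //.
by apply: leq_ltn_trans ltx; apply: leq_mod.
Qed.

Lemma run_div d x y : instr_at (IOp OpDiv d x y) -> d < 17 ->
  nth 0 rs x < 2 ^ w ->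
  wp sz t.+1 k.+1 (set_nth 0 rs d (nth 0 rs x %/ nth 0 rs y)) l Q ->
  wp sz t k rs l Q.
Proof.
move=> ik ltd ltx; apply: run_op ik ltd _; rewrite /= modn_small //.
by apply: leq_ltn_trans ltx; apply: leq_div.
Qed.

Lemma ltn_bool_word (b : bool) : 1 < 2 ^ w -> b < 2 ^ w.
Proof. by move=> lt1; apply: leq_ltn_trans lt1; case: b. Qed.

Lemma run_lt d x y : instr_at (IOp OpLt d x y) -> d < 17 -> 1 < 2 ^ w ->
  wp sz t.+1 k.+1 (set_nth 0 rs d (nth 0 rs x < nth 0 rs y)) l Q ->
  wp sz t k rs l Q.
Proof.
by move=> ik ltd lt1; apply: run_op ik ltd _; rewrite /= modn_small // ltn_bool_word.
Qed.

Lemma run_eq d x y : instr_at (IOp OpEq d x y) -> d < 17 -> 1 < 2 ^ w ->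
  wp sz t.+1 k.+1 (set_nth 0 rs d (nth 0 rs x == nth 0 rs y)) l Q ->
  wp sz t k rs l Q.
Proof.
by move=> ik ltd lt1; apply: run_op ik ltd _; rewrite /= modn_small // ltn_bool_word.
Qed.

Lemma run_getn d : instr_at (IGetN d) -> d < 17 -> n < 2 ^ w ->
  wp sz t.+1 k.+1 (set_nth 0 rs d n) l Q -> wp sz t k rs l Q.
Proof.
move=> ik ltd ltx; rewrite -{1}(modn_small ltx); apply: run_set => // c pck *.
by rewrite /step pck /= ik.
Qed.

Lemma run_deg d x (v : 'I_n) : instr_at (IGetDeg d x) -> d < 17 ->
  nth 0 rs x = v.+1 -> size (adj v) < 2 ^ w ->
  wp sz t.+1 k.+1 (set_nth 0 rs d (size (adj v))) l Q -> wp sz t k rs l Q.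
Proof.
move=> ik ltd rx ltx; rewrite -{1}(modn_small ltx); apply: run_set => // c pck regc _ _.
by rewrite /step pck /= ik regc rx /= valK.
Qed.

Lemma run_nbr d x i (v z : 'I_n) : instr_at (IGetNbr d x i) -> d < 17 ->
  nth 0 rs x = v.+1 -> onth (adj v) (nth 0 rs i) = Some z -> z.+1 < 2 ^ w ->
  wp sz t.+1 k.+1 (set_nth 0 rs d z.+1) l Q -> wp sz t k rs l Q.
Proof.
move=> ik ltd rx iz ltx; rewrite -{1}(modn_small ltx); apply: run_set => // c pck regc _ _.
by rewrite /step pck /= ik !regc rx /= valK iz.
Qed.

Lemma run_written d a : instr_at (ILazyWritten d a) -> d < 17 ->
  nth 0 rs a < sz -> 1 < 2 ^ w ->
  wp sz t.+1 k.+1 (set_nth 0 rs d (isSome (l (nth 0 rs a)))) l Q ->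
  wp sz t k rs l Q.
Proof.
move=> ik ltd lta lt1.
rewrite -{1}(modn_small (ltn_bool_word (isSome (l (nth 0 rs a))) lt1)).
apply: run_set => // c pck regc lc szc.
by rewrite /step pck /= ik !regc lc szc lta.
Qed.

Lemma run_load d a x : instr_at (ILazyLoad d a) -> d < 17 ->
  nth 0 rs a < sz -> l (nth 0 rs a) = Some x -> x < 2 ^ w ->
  wp sz t.+1 k.+1 (set_nth 0 rs d x) l Q -> wp sz t k rs l Q.
Proof.
move=> ik ltd lta la ltx; rewrite -{1}(modn_small ltx).
apply: run_set => // c pck regc lc szc.
by rewrite /step pck /= ik !regc lc szc lta la.
Qed.

Lemma run_store a x : instr_at (ILazyStore a x) -> nth 0 rs a < sz ->
  wp sz t.+1 k.+1 rs (upd l (nth 0 rs a) (Some (nth 0 rs x))) Q ->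
  wp sz t k rs l Q.
Proof.
move=> ik lta r c pck regc lc hwc szc.
have [|||||s [c' [en Qs hw' sz']]] := r (store_lazy c (nth 0 rs a) (nth 0 rs x)) => //=.
- by rewrite pck.
- by rewrite lc.
exists s, c'; split=> //; apply: enum_next en.
by rewrite /step pck /= ik !regc szc lta.
Qed.

Lemma run_alloc d s : instr_at (ILazyAlloc d s) -> d < 17 ->
  sz + nth 0 rs s <= 2 ^ w -> sz < 2 ^ w ->
  wp (sz + nth 0 rs s) t.+1 k.+1 (set_nth 0 rs d sz) l Q -> wp sz t k rs l Q.
Proof.
move=> ik ltd les lts r c pck regc lc hwc szc.
have [|||||o [c' [en Qs hw' sz']]] :=
  r (set_reg w apsd_program (grow_lazy c (nth 0 rs s)) d sz) => //=.
- by rewrite pck.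
- by move=> i; rewrite ltd nth_set_nth /= /upd regc modn_small.
- by rewrite szc.
exists o, c'; split=> //; apply: enum_next en.
by rewrite /step pck /= ik !regc szc les.
Qed.

Lemma run_jump j : instr_at (IJump j) ->
  wp sz t.+1 j rs l Q -> wp sz t k rs l Q.
Proof.
move=> ik r c pck regc lc hwc szc.
have [|||||s [c' [en Qs hw' sz']]] := r (goto c j) => //=.
exists s, c'; split=> //; apply: enum_next en.
by rewrite /step pck /= ik.
Qed.

Lemma run_jumpz x j : instr_at (IJumpZ x j) ->
  wp sz t.+1 (if nth 0 rs x == 0 then j else k.+1) rs l Q -> wp sz t k rs l Q.
Proof.
move=> ik r c pck regc lc hwc szc.
have [|||||s [c' [en Qs hw' sz']]] :=
  r (goto c (if nth 0 rs x == 0 then j else k.+1)) => //=.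
exists s, c'; split=> //; apply: enum_next en.
by rewrite /step pck /= ik regc.
Qed.

(** The delay is checked at an output, where the counter restarts. *)
Lemma run_out u v x : instr_at (IOut u v x) -> t < D ->
  wp sz 0 k.+1 rs l (fun s => Q ((nth 0 rs u, nth 0 rs v, Some (nth 0 rs x)) :: s)) ->
  wp sz t k rs l Q.
Proof.
move=> ik ltD r c pck regc lc hwc szc.
have [|||||s [c' [en Qs hw' sz']]] := r (goto c k.+1) => //=.
exists ((nth 0 rs u, nth 0 rs v, Some (nth 0 rs x)) :: s), c'; split=> //.
apply: enum_emit en => //; by rewrite /step pck /= ik !regc.
Qed.

Lemma run_outinf u v : instr_at (IOutInf u v) -> t < D ->
  wp sz 0 k.+1 rs l (fun s => Q ((nth 0 rs u, nth 0 rs v, None) :: s)) ->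
  wp sz t k rs l Q.
Proof.
move=> ik ltD r c pck regc lc hwc szc.
have [|||||s [c' [en Qs hw' sz']]] := r (goto c k.+1) => //=.
exists ((nth 0 rs u, nth 0 rs v, None) :: s), c'; split=> //.
apply: enum_emit en => //; by rewrite /step pck /= ik !regc.
Qed.

Lemma run_halt : instr_at IHalt -> t < D -> sz = n * n + n * n -> Q [::] ->
  wp sz t k rs l Q.
Proof.
move=> ik ltD szE Q0 c pck regc lc hwc szc; exists [::], c; split=> //.
  by apply: enum_stop => //; rewrite /step pck /= ik.
by rewrite szc.
Qed.

Lemma run_weaken (Q' : seq triple -> Prop) : (forall s, Q' s -> Q s) ->
  wp sz t k rs l Q' -> wp sz t k rs l Q.
Proof.
move=> QQ r c e1 e2 e3 e4 e5; have [s [c' [en Qs hw szc]]] := r c e1 e2 e3 e4 e5.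
by exists s, c'; split=> //; apply: QQ.
Qed.

End Instructions.

End Machine.

(** * Correctness and delay of the program *)

Section Loops.

Variables (n : nat) (e : rel 'I_n) (adj : 'I_n -> seq 'I_n) (w D Dlt : nat).
Hypothesis adjP : adjacency_lists e adj.
(** Both arrays together need [2 * (n * n)] addresses; the rest leaves room for sums of one-based
    vertices and for Booleans when [n = 0]. *)
Hypothesis word_large : 2 * (n * n) + 2 * n + 2 <= 2 ^ w.
Hypothesis size_adj : forall v, size (adj v) <= Dlt.
Hypothesis delay_large : 27 * Dlt + 40 <= D.

Local Notation N := (n * n).
Local Notation dx := (code_dist e).
Local Notation run := (wp w adj D (N + N)).
Local Notation bfs_inv := (bfs_inv N (code_succ e) dx).

Definition represents (l : nat -> option nat) (A P : nat -> nat) : Prop :=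
  forall i, i < N -> odflt i (l i) = A i /\ odflt i (l (N + i)) = P i.

(** The four stores mirror the two swaps; cells below [N] and cells from [N] on cannot collide. *)
Lemma represents_enqueue l A P T y : represents l A P -> inverse_on N A P ->
  T < N -> y < N ->
  represents (upd (upd (upd (upd l T (Some y)) (N + y) (Some T))
                 (P y) (Some (A T))) (N + A T) (Some (P y)))
    (enqueue_arr A P T y) (enqueue_pos A P T y).
Proof.
move=> lAP AP ltT lty i lti; have [Ai Pi] := lAP i lti.
have [AT _ _ _] := AP T ltT; have [_ Py _ _] := AP y lty.
have neN b : (i == N + b) = false by lia.
have neN' a : a < N -> (N + i == a) = false by lia.
rewrite /enqueue_arr /enqueue_pos /upd !neN (neN' T) // (neN' (P y)) // !eqn_add2l.
by split; do 2 ?[case: eqP => //= _].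
Qed.

(** Symbolic execution: [reflexivity] reads the instruction off the code, and the nontrivial side
    conditions remain. *)
Ltac exec rule := eapply rule; [reflexivity | ..]; simpl; try done.
Ltac exec_load a := eapply run_load with (x := a); [reflexivity | ..]; simpl; try done.

(** 14 counts the path that loads a written cell; an unwritten one saves a step. Scratch registers
    are arbitrary, being overwritten before they are read. *)
Lemma run_fetch t h T L d A P l Q js (u v : 'I_n) : size js = 9 -> represents l A P ->
  inverse_on N A P -> h < N -> A h = pair_code n u v ->
  (forall b a10 a13 a14 a15 a16, run (t + 14) (if h < T then 21 else 56)
     [:: 0; 1; n; N; h; T; L; d; u : nat; v.+1; a10; u.+1; b; a13; a14; a15; a16] l Q) ->
  run t 7 ([:: 0; 1; n; N; h; T; L; d] ++ js) l Q.
Proof.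
case: js => [|a8 [|a9 [|a10 [|a11 [|a12 [|a13 [|a14 [|a15 [|a16 []]]]]]]]]] //= _.
move=> lAP AP lth Ah K; have [Ah' _] := lAP h lth.
have lt1 : 1 < 2 ^ w by lia.
exec run_lt; rewrite lth; exec run_jumpz.
exec run_move; first by lia.
(* Position 13 is reached with the same code in register 12 whether or not the cell was written. *)
have K1 b : run (t + 6) 13 [:: 0; 1; n; N; h; T; L; d; a8; a9; a10; a11; pair_code n u v;
                b; a14; a15; a16] l Q.
  have ltp := ltn_pair_code u v.
  exec run_mod; first by lia.
  rewrite pair_code_src; exec run_div; first by lia.
  have := leq_div (pair_code n u v) n => led.
  exec run_add; first by have := ltn_ord u; nia.
  exec run_mod; first by have := ltn_ord u; lia.
  have := pair_code_target u v; rewrite /code_target pair_code_src => ->.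
  exec run_add; first by have := ltn_ord u; lia.
  exec run_add; first by have := ltn_ord v; lia.
  rewrite !addn1; exec run_lt; exec run_jumpz.
  rewrite eqb0 -if_neg negbK -!addnS; exact: K.
exec run_written; first by lia.
exec run_jumpz; rewrite -Ah -Ah' in K1 *.
case lh: (l h) K1 => [a|] /= K1; last by apply: run_le (K1 _); lia.
exec_load a; [by lia| |].
  by have := AP h lth; rewrite -Ah' lh /= => -[]; lia.
by apply: run_le (K1 _); lia.
Qed.

Lemma size_adj_leq v : size (adj v) <= n.
Proof.
have [/card_uniqP <- _] := adjP v.
by apply: leq_trans (max_card _) _; rewrite card_ord.
Qed.

(** The list is scanned downwards, so the neighbours of index at least [i] are already queued. Each
    costs at most 26 steps, within the budget of 27; the final test costs one more. [vis] fixes the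
    set of codes output so far, which the swaps preserve although [P] changes. *)
Lemma run_scan t h T L d A P l Q js (u v : 'I_n) i vis : size js = 5 ->
  represents l A P -> bfs_inv h T L d A P -> h < L -> A h = pair_code n u v ->
  i <= size (adj v) ->
  (forall j z, i <= j -> onth (adj v) j = Some z -> P (pair_code n u z) < T) ->
  (forall y, y < N -> (P y <= h) = vis y) ->
  (forall T' A' P' l' js', size js' = 5 -> represents l' A' P' ->
     bfs_inv h.+1 T' L d A' P' -> (forall y, y < N -> (P' y <= h) = vis y) ->
     run (t + 27 * i + 1) 54
       ([:: 0; 1; n; N; h; T'; L; d; u : nat; v.+1; 0; u.+1] ++ js') l' Q) ->
  run t 27 ([:: 0; 1; n; N; h; T; L; d; u : nat; v.+1; i; u.+1] ++ js) l Q.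
Proof.
have lt1 : 1 < 2 ^ w by lia.
have ltu := ltn_ord u; have ltv := ltn_ord v.
elim: i t T A P l js => [|i IHi] t T A P l js sjs lAP inv ltL Ah lei seen visP K.
  exec run_jumpz; rewrite -addn1 -[t in t + 1]addn0.
  apply: (K T A P l js) => //.
  apply: (bfs_dequeue inv) => // y lty [u' [v' [z [eqA yE vz]]]].
  move: eqA; rewrite Ah => /pair_code_inj[eu ev]; subst u' v' y.
  have /onthP[j zj] : z \in adj v by rewrite (adjP v).2.
  exact: (seen j).
have [[_ LT TN AP _ _ _ _] ltT] := (inv, leq_trans ltL (bfs_LT inv)).
case: js sjs => [|a12 [|a13 [|a14 [|a15 [|a16 []]]]]] //= _.
have [z zi] : exists z, onth (adj v) i = Some z.
  by have := onthTE (adj v) i; rewrite lei; case: onth => [z|//]; exists z.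
have ltz := ltn_ord z; have lti := leq_trans lei (size_adj_leq v).
exec run_jumpz; exec run_sub; first by lia.
rewrite subn1 /=; eapply run_nbr with (v := v) (z := z); [reflexivity | ..]; rewrite //=; first by lia.
exec run_add; first by lia.
exec run_sub; first by lia.
(* Target and source are one-based here, so the offsets cancel in the difference. *)
rewrite addSn subSS.
exec run_mod; first by lia.
have lty := ltn_pair_code u z; have ltm : (z + n - u) %% n < n by rewrite ltn_mod; lia.
have dy : (z + n - u) %% n * n + u = pair_code n u z by [].
exec run_mul; first by rewrite /pair_code in lty; lia.
exec run_add; first by rewrite dy; lia.
rewrite dy {ltm dy}; move eqy: (pair_code n u z) => y in lty *.
have Ay : code_succ e (A h) y.
  exists u, v, z; split=> //; rewrite -[e v z]/(z \in e v) -(adjP v).2.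
  by apply/onthP; exists i.
(* Shared continuation for a neighbour already visited and for one just enqueued. *)
have IH T1 A1 P1 l1 js : size js = 5 -> represents l1 A1 P1 ->
    bfs_inv h T1 L d A1 P1 -> A1 h = A h -> P1 y < T1 ->
    (forall x, x < N -> P x < T -> P1 x < T1) ->
    (forall x, x < N -> (P1 x <= h) = (P x <= h)) ->
    run (t + 27) 27 ([:: 0; 1; n; N; h; T1; L; d; u : nat; v.+1; i; u.+1] ++ js) l1 Q.
  move=> sjs lAP1 inv1 A1h P1y le1 vis1; apply: (IHi _ _ A1 P1) => //.
  - by rewrite A1h.
  - exact: ltnW.
  - move=> j z'; rewrite leq_eqVlt => /orP[/eqP <-|ltj zj].
      by rewrite zi => -[<-]; rewrite eqy.
    by apply: le1; [apply: ltn_pair_code | apply: seen zj].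
  - by move=> x ltx; rewrite vis1 ?visP.
  - move=> T' A' P' l' js' *; rewrite -(addnA t) -mulnS; exact: (K T' A' P').
have [Ay' Py PAy APy] := AP y lty.
have [_ ly] := lAP y lty.
exec run_add; first by lia.
exec run_move; first by lia.
have K1 b : run (t + 13) 40 [:: 0; 1; n; N; h; T; L; d; u : nat; v.+1; i; u.+1;
    y; N + y; P y; b; a16] l Q.
  exec run_lt; exec run_jumpz; rewrite eqb0 -leqNgt; case: ltnP => [ltP|leP] /=.
    exec run_jump; apply: run_le (IH T A P l [:: _; _; _; _; _] _ _ _ _ _ _ _) => //.
    by lia.
  have ltTN : T < N by apply: leq_ltn_trans leP Py.
  have [lT _] := lAP T ltTN; have [AT _ _ _] := AP T ltTN.
  exec run_move; first by lia.
  have K2 b' : run (t + 19) 47 [:: 0; 1; n; N; h; T; L; d; u : nat; v.+1; i; u.+1;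
      y; N + y; P y; b'; A T] l Q.
    exec run_store; first by lia.
    exec run_store; first by lia.
    exec run_store; first by lia.
    exec run_add; first by lia.
    exec run_store; first by lia.
    exec run_add; first by lia.
    exec run_jump; rewrite addn1.
    apply: run_le (IH T.+1 (enqueue_arr A P T y) (enqueue_pos A P T y) _
      [:: _; _; _; _; _] _ _ _ _ _ _ _) => //; first by lia.
    - exact: represents_enqueue.
    - by apply: bfs_enqueue => //; apply: code_dist_succ.
    - exact: enqueue_arr_lt.
    - by rewrite (enqueue_pos_ltS AP) ?eqxx.
    - by move=> x ltx ltP; rewrite (enqueue_pos_ltS AP) ?ltP ?orbT.
    - by move=> x ltx; rewrite -[_ <= h]ltnS (enqueue_pos_lt AP).
  exec run_written; first by lia.
  exec run_jumpz.
  case E: (l T) lT K2 => [a|] /= lT K2; last by rewrite -lT in K2; apply: run_le (K2 _); lia.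
  exec_load (A T); [by lia | by rewrite E lT | by lia |].
  by apply: run_le (K2 _); lia.
exec run_written; first by lia.
exec run_jumpz.
case E: (l (N + y)) ly K1 => [a|] /= ly K1; last by rewrite -ly in K1; apply: run_le (K1 _); lia.
exec_load (P y); [by lia | by rewrite E ly | by lia |].
by apply: run_le (K1 _); lia.
Qed.

Local Notation listed h d P :=
  (fun s => exists2 xs, s = map (code_triple e) xs & suffix_listing N dx h d P xs).

Lemma run_stop t h T L d d' l js A P : size js = 9 -> inverse_on N A P ->
  N <= h -> t + 2 < D ->
  run t 7 ([:: 0; 1; n; N; h; T; L; d] ++ js) l (listed h d' P).
Proof.
case: js => [|a8 [|a9 [|a10 [|a11 [|a12 [|a13 [|a14 [|a15 [|a16 []]]]]]]]]] //= _.
move=> AP leN ltD; have lt1 : 1 < 2 ^ w by lia.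
exec run_lt; rewrite ltnNge leN /=; exec run_jumpz.
exec run_halt; first by lia.
by exists [::] => //; apply: suffix_listing_nil AP leN.
Qed.

(** The permutation no longer changes, so each round costs a constant; the entry counter is that of
    [run_bfs], from which this loop is entered. *)
Lemma run_unreachable h T L d l js A P : size js = 9 -> represents l A P ->
  inverse_on N A P -> T <= h ->
  (forall x, x < N -> T <= P x -> dx x = None) ->
  run (27 * Dlt + 10) 7 ([:: 0; 1; n; N; h; T; L; d] ++ js) l (listed h None P).
Proof.
move eqk: (N - h) => k sjs lAP AP leT unr.
elim: k h js eqk sjs leT => [|k IHk] h js eqk sjs leT.
  by apply: (run_stop _ sjs AP) => //; lia.
have lth : h < N by lia.
have [Ah _ PAh _] := AP h lth; have [u [v Ahuv]] := pair_codeP Ah.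
have dAh : dx (A h) = None by apply: unr; rewrite ?PAh.
apply: (run_fetch sjs lAP AP lth Ahuv) => b a10 a13 a14 a15 a16.
rewrite ltnNge leT /=; exec run_outinf; first by lia.
exec run_jump; exec run_add; first by lia.
exec run_jump; rewrite addn1.
apply: (run_le (t' := 27 * Dlt + 10)); first by lia.
apply: run_weaken (IHk h.+1 [:: _; _; _; _; _; _; _; _; _] _ _ _) => //; try by lia.
move=> s [xs -> xsP]; exists (A h :: xs).
  by rewrite /= /code_triple dAh Ahuv pair_code_src pair_code_target.
by apply: suffix_listing_cons; rewrite ?dAh.
Qed.

(** The entry counter covers the scan after the previous output as well as the initial instructions.
    [d < L] keeps the distance register from overflowing and persists because every new level
    contains a code; it fails only initially for [n = 0], hence the guard [h < N]. *)
Lemma run_bfs h T L d l js A P : size js = 9 -> represents l A P ->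
  bfs_inv h T L d A P -> (h < N -> d < L) ->
  run (27 * Dlt + 10) 7 ([:: 0; 1; n; N; h; T; L; d] ++ js) l
    (listed h (Some d) P).
Proof.
have lt1 : 1 < 2 ^ w by lia.
move eqk: (N - h) => k.
elim: k h T L d l js A P eqk => [|k IHk] h T L d l js A P eqk sjs lAP inv ltd.
  by apply: (run_stop _ sjs (bfs_inverse inv)) => //; lia.
have lth : h < N by lia.
have [leh LT TN AP _ _ _ _] := inv.
have [leT|ltT] := leqP T h.
  (* [h <= L <= T <= h]: the queue is empty, and only unreachable codes remain. *)
  have eqh : h = T by lia.
  rewrite -eqh in inv *; apply: run_weaken (run_unreachable sjs lAP AP _ _) => //.
    by move=> s [xs -> xsP]; exists xs => //; apply: suffix_listing_le xsP.
  by move=> x; apply: bfs_unreachable inv; apply: code_dist_pred.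
have [Ah _ PAh _] := AP h lth; have [u [v Ahuv]] := pair_codeP Ah.
have ltu := ltn_ord u; have ltv := ltn_ord v.
apply: (run_fetch sjs lAP AP lth Ahuv) => b a10 a13 a14 a15 a16.
rewrite ltT.
(* Position 25 is reached with or without a change of level. *)
have K L1 d1 b1 : bfs_inv h T L1 d1 A P -> h < L1 -> d1 < L1 ->
    run (27 * Dlt + 28) 25 [:: 0; 1; n; N; h; T; L1; d1; u : nat; v.+1; a10; u.+1;
      b1; a13; a14; a15; a16] l (listed h (Some d1) P).
  move=> inv1 ltL1 ltd1; exec run_out; first by lia.
  have dAh : dx (A h) = Some d1 by apply: (bfs_level inv1); rewrite leqnn.
  have lead := size_adj_leq v; have leD := size_adj v.
  eapply run_deg with (v := v); [reflexivity | ..]; rewrite //=; first by lia.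
  apply: (run_scan (js := [:: _; _; _; _; _]) (vis := fun y => P y <= h) _ lAP inv1 ltL1 Ahuv) => //.
    by move=> j z lej zj; have := onthTE (adj v) j; rewrite zj ltnNge lej.
  move=> T' A' P' l' [|c12 [|c13 [|c14 [|c15 [|c16 []]]]]] //= _ lAP' inv' vis'.
  exec run_add; first by lia.
  exec run_jump; rewrite (addn1 h).
  apply: (run_le (t' := 27 * Dlt + 10)); first by lia.
  apply: run_weaken (IHk h.+1 T' L1 d1 l' [:: _; _; _; _; _; _; _; _; _] A' P' _ _ _ _ _) => //; try by lia.
  move=> s [xs -> xsP]; exists (A h :: xs).
    by rewrite /= /code_triple dAh Ahuv pair_code_src pair_code_target.
  apply: suffix_listing_cons; rewrite ?dAh //=.
  (* The scan kept the set of codes at positions up to [h], so the listing for [P'] serves for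
     [P]. *)
  exact: suffix_listing_pos xsP.
exec run_eq; exec run_jumpz; rewrite eqb0; case: eqVneq => [eqhL|neL] /=.
  rewrite -eqhL in inv ltd *; have ltdh := ltd lth.
  exec run_add; first by lia.
  exec run_move; first by lia.
  rewrite addn1; apply: run_le (run_weaken _ (K T d.+1 _ _ _ _)) => //; try by lia.
    by move=> s [xs -> xsP]; exists xs => //; apply: suffix_listing_le xsP => /=.
  by apply: bfs_next_level inv; apply: code_dist_pred.
by apply: run_le (K L d _ _ _ _) => //; lia.
Qed.

Lemma run_init (g : nat -> nat) : exists s c,
  [/\ enumerates w apsd_program adj D 0 (init w g) s c, sorted_apsd e s,
    plain_hw c = 0 & lazy_size c = N + N].
Proof.
have lt1 : 1 < 2 ^ w by lia.
suff start : wp w adj D 0 0 0 (nseq 17 0) (fun _ => None) (listed 0 (Some 0) id).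
  have [|||||s [c [en [xs sE [uxs mxs pxs]] hw sz]]] := start (init w g) => //.
    by move=> i; rewrite nth_nseq if_same.
  exists s, c; split=> //; rewrite sE; split.
    by apply: code_triples_perm uxs _ => x; rewrite mxs andbT.
  by rewrite -map_comp; apply: path_sorted pxs.
rewrite /nseq /=.
exec run_const.
exec run_getn; first by lia.
exec run_mul; first by lia.
exec run_add; first by lia.
exec run_alloc; [by lia | by lia |].
exec run_move; first by lia.
exec run_move; first by lia.
apply: (run_le (t' := 27 * Dlt + 10)); first by lia.
(* Fresh cells represent the identity, whose first [n] codes are the diagonal, that is, level 0. *)
apply: (run_bfs (js := [:: _; _; _; _; _; _; _; _; _]) (A := id)) => //.
  by apply: bfs_init; [apply: code_dist0 | case: n => [|m] //=; lia].
by case: n.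
Qed.

End Loops.

Theorem theorem16 :
  exists (P : program) (kappa C : nat),
    forall (n : nat) (e : rel 'I_n) (adj : 'I_n -> seq 'I_n)
           (w : nat) (g : nat -> nat),
      adjacency_lists e adj ->
      kappa * (up_log 2 n).+1 <= w ->
      exists (s : seq triple) (c : config),
        [/\ enumerates w P adj (C * maxn 1 (max_outdeg e)) 0 (init w g) s c,
            sorted_apsd e s,
            0 < n -> n ^ 2 <= C * lazy_size c /\ lazy_size c <= C * n ^ 2
          & 0 < n -> n ^ 2 <= C * space_used P c /\ space_used P c <= C * n ^ 2].
Proof.
(* The factor 3 gives [(2 * m) ^ 3 <= 2 ^ w] for a power of two [m >= n]. The constant 70 exceeds
   both 27 + 40, for the delay, and 17 + 2, for the registers and the two arrays. *)
exists apsd_program, 3, 70 => n e adj w g adjP lew.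
have word_large : 2 * (n * n) + 2 * n + 2 <= 2 ^ w.
  have : 2 ^ (3 * (up_log 2 n).+1) <= 2 ^ w by rewrite leq_exp2l.
  apply: leq_trans; rewrite (mulnC 3) expnM (expnS 2 (up_log 2 n)).
  have := up_logP n (isT : 1 < 2); set m := 2 ^ _ => lenm.
  have lt0m : 0 < m by rewrite expn_gt0.
  have lesq : n * n <= m * m by apply: leq_mul.
  have leq1 : m <= m * m by apply: leq_pmulr.
  have leq2 : m * m <= m * (m * m) by apply: leq_pmull.
  have -> : (2 * m) ^ 3 = 8 * (m * (m * m)) by rewrite expnMn !(expnS m) expn0 muln1.
  lia.
have size_adj v : size (adj v) <= max_outdeg e.
  have [/card_uniqP <- adjE] := adjP v; rewrite (eq_card adjE).
  exact: (leq_bigmax v).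
have [|s [c [en srt hw sz]]] :=
  run_init adjP word_large size_adj (D := 70 * maxn 1 (max_outdeg e)) _ g; first by lia.
exists s, c; split=> //= n0; rewrite /space_used ?hw sz /= -mulnn; nia.
Qed.
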